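(* Let $L$ be an infinitely distributive lattice and let $A\subseteq L$ be an ideal. Then $A_1^{O}=A_1^{\mathfrak{u}O}$, and both are $\mathfrak{u}$O-closed (and therefore O-closed) ideals of $L$.
   Context: A subset $A$ of a lattice $L$ is a down-set if $a\in A$, $x\in L$, $x\le a$ imply $x\in A$; it is an ideal if it is a down-set and $a\vee b\in A$ for all $a,b\in A$. A subset of a poset is directed (resp. filtered) if it is non-empty and each of its finite subsets has an upper bound (resp. lower bound) in it. A net $(x_\gamma)_{\gamma\in\Gamma}$ in $L$ O-converges to $x\in L$ if there exist a directed set $M\subseteq L$ and a filtered set $N\subseteq L$ with $\bigvee M=\bigwedge N=x$ such that for every $(m,n)\in M\times N$ there is $\gamma_0\in\Gamma$ with $m\le x_\gamma\le n$ for all $\gamma\ge\gamma_0$. The net $\mathfrak{u}$O-converges to $x$ if $((x_\gamma\wedge t)\vee s)_{\gamma\in\Gamma}$ O-converges to $(x\wedge t)\vee s$ for every $s,t\in L$ with $s\le t$. A lattice $L$ is infinitely distributive if for every $x\in L$ and every family $\{x_\alpha\}_{\alpha\in\mathcal A}\subseteq L$: whenever $\bigwedge_\alpha x_\alpha$ exists, $x\vee\bigwedge_\alpha x_\alpha=\bigwedge_\alpha(x\vee x_\alpha)$; and whenever $\bigvee_\alpha x_\alpha$ exists, $x\wedge\bigvee_\alpha x_\alpha=\bigvee_\alpha(x\wedge x_\alpha)$. For $X\subseteq L$, $X_1^{O}$ (resp. $X_1^{\mathfrak{u}O}$) is the set of all $x\in L$ for which there is a net in $X$ that O-converges (resp.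 $\mathfrak{u}$O-converges) to $x$. $X$ is O-closed (resp. $\mathfrak{u}$O-closed) if $X=X_1^{O}$ (resp. $X=X_1^{\mathfrak{u}O}$). *)

(* Defs.v *)
From mathcomp Require Import all_boot all_order.
From mathcomp Require Import boolp classical_sets functions cardinality.

Set Implicit Arguments.
Unset Strict Implicit.
Unset Printing Implicit Defensive.

Import Order.TTheory.

Local Open Scope classical_set_scope.

Definition directed (d : Order.disp_t) (P : porderType d) (A : set P) : Prop :=
  A !=set0 /\
  forall F : set P, finite_set F -> F `<=` A -> exists2 u, A u & ubound F u.

Definition filtered (d : Order.disp_t) (P : porderType d) (A : set P) : Prop :=
  A !=set0 /\
  forall F : set P, finite_set F -> F `<=` A -> exists2 l, A l & lbound F l.

Definition is_down_set (d : Order.disp_t) (L : latticeType d) (A : set L) :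
    Prop :=
  forall a x : L, A a -> (x <= a)%O -> A x.

(* The empty set counts as an ideal. *)
Definition is_ideal (d : Order.disp_t) (L : latticeType d) (A : set L) : Prop :=
  is_down_set A /\ forall a b : L, A a -> A b -> A (Order.join a b).

(* [supremums A x] (resp. [infimums A x]) says that the join (resp. meet) of A
   exists and equals x. *)
Definition infinitely_distributive (d : Order.disp_t) (L : latticeType d) :
    Prop :=
  forall (x : L) (I : Type) (f : I -> L),
    (forall y : L, infimums (range f) y ->
       infimums (range (fun i => Order.join x (f i))) (Order.join x y)) /\
    (forall y : L, supremums (range f) y ->
       supremums (range (fun i => Order.meet x (f i))) (Order.meet x y)).

(* Directedness of the index poset G is required where nets are quantified
   over, not here. *)
Definition O_converges (d : Order.disp_t) (L : latticeType d)
    (dG : Order.disp_t) (G : porderType dG) (u : G -> L) (x : L) : Prop :=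
  exists M N : set L,
    [/\ directed M, filtered N, supremums M x, infimums N x &
        forall m n : L, M m -> N n ->
          exists g0 : G, forall g : G, (g0 <= g)%O -> (m <= u g <= n)%O].

Definition uO_converges (d : Order.disp_t) (L : latticeType d)
    (dG : Order.disp_t) (G : porderType dG) (u : G -> L) (x : L) : Prop :=
  forall s t : L, (s <= t)%O ->
    O_converges (fun g => Order.join (Order.meet (u g) t) s)
                (Order.join (Order.meet x t) s).

Definition O_adherence (d : Order.disp_t) (L : latticeType d) (X : set L) :
    set L :=
  [set x | exists (dG : Order.disp_t) (G : porderType dG) (u : G -> L),
     [/\ directed [set: G], forall g, X (u g) & O_converges u x]].

Definition uO_adherence (d : Order.disp_t) (L : latticeType d) (X : set L) :
    set L :=
  [set x | exists (dG : Order.disp_t) (G : porderType dG) (u : G -> L),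
     [/\ directed [set: G], forall g, X (u g) & uO_converges u x]].

Definition O_closed (d : Order.disp_t) (L : latticeType d) (X : set L) : Prop :=
  X = O_adherence X.

Definition uO_closed (d : Order.disp_t) (L : latticeType d) (X : set L) :
    Prop :=
  X = uO_adherence X.

(* Main.v *)
Require Import Defs.
From mathcomp Require Import all_boot all_order.
From mathcomp Require Import boolp classical_sets cardinality.

(** Both adherences of an ideal [A] turn out to be the set of those [x] that
    are the join of the elements of [A] below [x], as soon as [A] is nonempty
    ([O_adherence_idealP]).

    If a net in [A] O-converges to [x] with lower witness [M], every [m] in [M]
    lies below some member of the net, hence belongs to the down-set [A], and
    [x] is the join of [M].  Conversely a directed subset [M] of [A] with join
    [x], indexed by itself, is an increasing net in [A] that O-converges to
    [x]; infinite distributivity makes all its truncations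
    [(m /\ t) \/ s] increase to [(x /\ t) \/ s], so it also uO-converges to
    [x] ([sub_O_uO_adherence]).

    A net [u] in [A] that uO-converges to [x] need not O-converge, but a single
    truncation of it does, and stays in [A]: take [t := x] and
    [s := u g0 /\ x] for any index [g0], so that [(x /\ t) \/ s = x]
    ([sub_uO_O_adherence]).  Hence the two adherences coincide.

    From the description by joins, the adherence is a down-set (distribute
    [y /\ _] over the join of the elements of [A] below [x]), is stable under
    joins, and adhering twice gives nothing new, since a join of joins of
    elements of [A] is a join of elements of [A].  Being an ideal itself, it
    has the same O- and uO-adherence, namely itself. *)

Set Implicit Arguments.
Unset Strict Implicit.
Unset Printing Implicit Defensive.

Import Order.TTheory.

Local Open Scope classical_set_scope.

(** Directed subsets serve as index posets of nets; [sub_type] is what carries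
    the order induced from [P]. *)
Lemma directed_sub_type (d : Order.disp_t) (P : porderType d) (M : set P) :
  directed M -> @directed d _ [set: sub_type (set_type M)].
Proof.
move=> [[m Mm] dirM]; split; first by exists (exist _ m (mem_set Mm)).
move=> F finF _.
have [u Mu ubu] : exists2 u, M u & ubound (val @` F) u.
  apply: dirM; first exact: finite_image.
  by move=> _ [g _ <-]; exact: set_mem (valP g).
exists (exist _ u (mem_set Mu)) => // g Fg.
by rewrite -Order.le_val /=; apply: ubu; exists g.
Qed.

Lemma directed1 (d : Order.disp_t) (P : porderType d) (x : P) : directed [set x].
Proof.
by split; [exists x | move=> F _ Fx; exists x => // y /Fx ->].
Qed.

Lemma filtered1 (d : Order.disp_t) (P : porderType d) (x : P) : filtered [set x].
Proof.
by split; [exists x | move=> F _ Fx; exists x => // y /Fx ->].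
Qed.

Lemma directed_image (d d' : Order.disp_t) (P : porderType d)
    (Q : porderType d') (f : P -> Q) (M : set P) :
  {homo f : a b / (a <= b)%O} -> directed M -> directed (f @` M).
Proof.
move=> homof [[m Mm] dirM]; split; first by exists (f m), m.
move=> F finF FM.
(* A finite part of the image is the image of a finite part of M. *)
have [h hP] : exists h : Q -> P, forall y, F y -> M (h y) /\ f (h y) = y.
  have /choice[h hP] : forall y, exists x, F y -> M x /\ f x = y.
    move=> y; have [/FM[x Mx fx]|nFy] := pselect (F y); first by exists x.
    by exists m => /nFy.
  by exists h.
have [u Mu ubu] : exists2 u, M u & ubound (h @` F) u.
  apply: dirM; first exact: finite_image.
  by move=> _ [y Fy <-]; case: (hP y Fy).
exists (f u); first by exists u.
move=> y Fy; have [_ <-] := hP y Fy.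
by apply: homof; apply: ubu; exists y.
Qed.

Section Lattice.
Variables (d : Order.disp_t) (L : latticeType d).
Implicit Types (A M X : set L) (x y s t : L).

Lemma supremums1 x : supremums [set x] x.
Proof. by split=> [_ ->//|y]; apply. Qed.

Lemma infimums1 x : infimums [set x] x.
Proof. by split=> [_ ->//|y]; apply. Qed.

Lemma directed_ideal A : is_ideal A -> A !=set0 -> directed A.
Proof.
move=> [_ joinA] [a0 Aa0]; split; first by exists a0.
move=> F /finite_seqP[r ->].
elim: r => [_|a r IHr subA]; first by exists a0 => // y; rewrite /= in_nil.
have [|u Au ubu] := IHr.
  by move=> y /= ry; apply: subA; rewrite /= inE ry orbT.
exists (Order.join a u).
  by apply: joinA => //; apply: subA; rewrite /= inE eqxx.
move=> y /=; rewrite inE => /orP[/eqP->|ry]; first exact: leUl.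
exact: le_trans (ubu _ ry) (leUr _ _).
Qed.

Lemma ideal_below A x :
  is_ideal A -> is_ideal (A `&` [set a | (a <= x)%O]).
Proof.
move=> [downA joinA]; split=> [a b [Aa ax] ba|a b [Aa ax] [Ab bx]].
  by split; [exact: downA ba | exact: le_trans ba ax].
by split; [exact: joinA | rewrite /= leUx ax bx].
Qed.

(** A directed set indexed by itself is the prototype of an increasing net; the
    monotone [f] accounts for its truncations. *)
Lemma O_converges_directed M (f : L -> L) y :
  {homo f : a b / (a <= b)%O} -> directed M -> supremums (f @` M) y ->
  @O_converges d L d (sub_type (set_type M)) (fun g => f (val g)) y.
Proof.
move=> homof dirM supM; exists (f @` M), [set y].
split=> //; [exact: directed_image | exact: filtered1 | exact: infimums1 |].
move=> _ _ [m Mm <-] ->; exists (exist _ m (mem_set Mm)) => g.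
rewrite -Order.le_val /= => mg; rewrite homof //=.
by apply: supM.1; exists (val g) => //; exact: set_mem (valP g).
Qed.

Lemma O_adherence_directed X M x :
  directed M -> M `<=` X -> supremums M x -> O_adherence X x.
Proof.
move=> dirM MX supM; exists d, (sub_type (set_type M)), val; split.
- exact: directed_sub_type.
- by move=> g; apply: MX; exact: set_mem (valP g).
- by apply: (O_converges_directed (f := id)) => //; rewrite image_id.
Qed.

Lemma sub_O_adherence X : X `<=` O_adherence X.
Proof.
move=> x Xx; apply: (@O_adherence_directed _ [set x]).
- exact: directed1.
- by move=> _ ->.
- exact: supremums1.
Qed.

(** The lower witness of O-convergence lies in the down-set [A], because each
    of its elements is below a member of the net. *)
Lemma O_adherence_down_set A x :
  is_down_set A -> O_adherence A x ->
  exists M, [/\ directed M, M `<=` A & supremums M x].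
Proof.
move=> downA [dG [G [u [_ Au [M [N [dirM [[n Nn] _] supM _ Mu]]]]]]].
exists M; split=> // m Mm; have [g0 /(_ g0 (lexx _)) /andP[mu _]] := Mu m n Mm Nn.
exact: downA (Au g0) mu.
Qed.

(** Nonemptiness has to be recorded: the empty ideal has no net, whereas a
    bottom element is the join of the empty set. *)
Lemma O_adherence_idealP A x :
  is_ideal A ->
  O_adherence A x <->
  A !=set0 /\ supremums (A `&` [set a | (a <= x)%O]) x.
Proof.
move=> idA; split.
  move=> /(O_adherence_down_set idA.1)[M [[[m Mm] _] MA [ubM lubM]]].
  split; first by exists m; exact: MA.
  split=> [a []//|y uby]; apply: lubM => a Ma; apply: uby.
  by split; [exact: MA | exact: ubM].
move=> [[a0 Aa0] supx]; apply: O_adherence_directed supx => [|a []//].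
apply: directed_ideal; first exact: ideal_below.
exists (Order.meet a0 x); split; last exact: leIr.
by apply: idA.1 Aa0 _; exact: leIl.
Qed.

(** The truncation of [u] between [u g0 /\ x] and [x] consists of joins of two
    elements below members of the net, so it is again a net in the ideal. *)
Lemma sub_uO_O_adherence A :
  is_ideal A -> uO_adherence A `<=` O_adherence A.
Proof.
move=> [downA joinA] x [dG [G [u [dirG Au uOx]]]].
have [[g0 _] _] := dirG.
exists dG, G; pose s := Order.meet (u g0) x.
exists (fun g => Order.join (Order.meet (u g) x) s); split=> //.
  move=> g; have Aux h : A (Order.meet (u h) x) by apply: downA (Au h) (leIl _ _).
  exact: joinA (Aux g) (Aux g0).
have sx : (s <= x)%O by exact: leIr.
by have := uOx s x sx; rewrite meetxx (join_l sx).
Qed.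

(** [M] must be nonempty: if [x] is a bottom element, it is the join of the
    empty set, but [x \/ s] need not be. *)
Lemma supremums_join M x s :
  M !=set0 -> supremums M x ->
  supremums ((fun m => Order.join m s) @` M) (Order.join x s).
Proof.
move=> [m0 Mm0] [ubM lubM]; split=> [_ [m Mm <-]|y uby].
  by apply: leU2 => //; exact: ubM.
have le_y m : M m -> (Order.join m s <= y)%O by move=> Mm; apply: uby; exists m.
rewrite leUx; apply/andP; split; last first.
  exact: le_trans (leUr _ _) (le_y m0 Mm0).
by apply: lubM => m Mm; exact: le_trans (leUl _ _) (le_y m Mm).
Qed.

Hypothesis hL : infinitely_distributive L.

Lemma supremums_meet M x t :
  supremums M x ->
  supremums ((fun m => Order.meet m t) @` M) (Order.meet x t).
Proof.
move=> supM; have range_val : range (val : set_type M -> L) = M.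
  apply/seteqP; split=> [_ [g _ <-]|m Mm]; first exact: set_mem (valP g).
  by exists (SigSub (mem_set Mm)).
have [_] := hL t (val : set_type M -> L).
move=> /(_ x); rewrite range_val => /(_ supM).
rewrite -[X in supremums X _](image_comp val (Order.meet t)) range_val meetC.
by congr (supremums _ _); apply: eq_imagel => m _; rewrite meetC.
Qed.

Lemma sub_O_uO_adherence A :
  is_down_set A -> O_adherence A `<=` uO_adherence A.
Proof.
move=> downA x /(O_adherence_down_set downA)[M [dirM MA supM]].
exists d, (sub_type (set_type M)), val; split.
- exact: directed_sub_type.
- by move=> g; apply: MA; exact: set_mem (valP g).
move=> s t _.
apply: (O_converges_directed (f := fun m => Order.join (Order.meet m t) s)) => //.
  by move=> a b ab; apply: leU2 => //; apply: leI2.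
rewrite -(image_comp (fun m => Order.meet m t) (fun m => Order.join m s)).
apply: supremums_join; last exact: supremums_meet.
by case: dirM => -[m Mm] _; exists (Order.meet m t), m.
Qed.

Lemma O_adherence_uO_adherence A :
  is_ideal A -> O_adherence A = uO_adherence A.
Proof.
move=> idA; apply/seteqP; split; last exact: sub_uO_O_adherence.
exact: sub_O_uO_adherence idA.1.
Qed.

(** Distributivity is what makes the adherence a down-set; its stability under
    joins is only associativity of joins. *)
Lemma O_adherence_is_ideal A : is_ideal A -> is_ideal (O_adherence A).
Proof.
move=> idA; split=> [x y|x y].
  move=> /(O_adherence_idealP _ idA)[A0 supx] yx.
  apply/O_adherence_idealP => //; split=> //; split=> [a []//|z ubz].
  (* y = x /\ y is the join of the a /\ y, for a in A below x. *)
  rewrite -(meet_r yx); have [_] := supremums_meet y supx; apply.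
  move=> _ [a [Aa _] <-]; apply: ubz; split; last exact: leIr.
  by apply: idA.1 Aa _; exact: leIl.
move=> /(O_adherence_idealP _ idA)[A0 [_ lubx]].
move=> /(O_adherence_idealP _ idA)[_ [_ luby]].
apply/O_adherence_idealP => //; split=> //; split=> [a []//|z ubz].
rewrite leUx; apply/andP; split; [apply: lubx|apply: luby] => a [Aa ax].
  by apply: ubz; split=> //; exact: le_trans ax (leUl _ _).
by apply: ubz; split=> //; exact: le_trans ax (leUr _ _).
Qed.

(** A join of elements of the adherence is a join of joins of elements of [A]:
    an upper bound of the elements of [A] below [x] dominates every [m] in [M],
    hence [x]. *)
Lemma O_adherence_O_closed A : is_ideal A -> O_closed (O_adherence A).
Proof.
move=> idA; have [downB _] := O_adherence_is_ideal idA.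
apply/seteqP; split; first exact: sub_O_adherence.
move=> x /(O_adherence_down_set downB)[M [[[m Mm] _] MB [ubM lubM]]].
have [A0 _] := (O_adherence_idealP m idA).1 (MB m Mm).
apply/O_adherence_idealP => //; split=> //; split=> [a []//|z ubz].
apply: lubM => {A0} {}m {}Mm.
have [_ [_ lubm]] := (O_adherence_idealP m idA).1 (MB m Mm).
apply: lubm => a [Aa am]; apply: ubz; split=> //.
exact: le_trans am (ubM m Mm).
Qed.

End Lattice.

Theorem theorem16 (d : Order.disp_t) (L : latticeType d)
    (hL : infinitely_distributive L) (A : set L) (hA : is_ideal A) :
  O_adherence A = uO_adherence A /\
  [/\ is_ideal (O_adherence A), uO_closed (O_adherence A)
    & O_closed (O_adherence A)] /\
  [/\ is_ideal (uO_adherence A), uO_closed (uO_adherence A)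
    & O_closed (uO_adherence A)].
Proof.
have idB := O_adherence_is_ideal hL hA.
have closedB := O_adherence_O_closed hL hA.
have uclosedB : uO_closed (O_adherence A).
  by rewrite /uO_closed -(O_adherence_uO_adherence hL idB).
by rewrite -(O_adherence_uO_adherence hL hA).
Qed.
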